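(* Let $s\ge1$ and let $k_1,k_2\ge s$ be integers. For the LIM$(k_1,k_2,s)$ method with stepsize $h$, producing $y_1$ from $y_0$, one has: $$H(y_1)-H(y_0)=\begin{cases}0, & \text{if } H\in\Pi_\nu \text{ with } \nu\le 2k_2/s,\\[1mm] O(h^{2k_2+1}), & \text{otherwise}\quad (h\to0).\end{cases}$$
   Context: Consider the problem $\dot y=S(y)\nabla H(y)$, $t\in[0,h]$, $y(0)=y_0\in\mathbb{R}^m$, where $H$ is real-valued and $S(y)=-S(y)^\top$ is an $m\times m$ skew-symmetric matrix for every $y$. $S$ and $\nabla H$ are assumed to be of class $C^\infty$ in a neighborhood of $y_0$. $H\in\Pi_\nu$ means that $H$ is a polynomial of degree at most $\nu$ in its argument. $\{P_i\}_{i\ge0}$ denotes the Legendre polynomial basis orthonormal on $[0,1]$: $P_i$ has degree $i$, $P_0\equiv1$, and $\int_0^1P_i(x)P_j(x)\,dx=\delta_{ij}$. The method LIM$(k_1,k_2,s)$ (discrete line integral method with parameters $k_1,k_2,s$): let $(\hat c_\ell,\hat b_\ell)$, $\ell=1,\dots,k_1$, and $(c_\ell,b_\ell)$, $\ell=1,\dots,k_2$, be the abscissae and weights of the Gauss-Legendre quadrature formulae on $[0,1]$ with $k_1$ and $k_2$ nodes (of order $2k_1$ and $2k_2$), respectively. The method computes a polynomial $u$ of degree at most $s$, with values in $\mathbb{R}^m$, such that $$u(ch)=y_0+h\sum_{i=0}^{s-1}\int_0^cP_i(x)\,dx\,\hat\Gamma_i,\quad c\in[0,1],\qquad \hat\Gamma_i=\sum_{j=0}^{s-1}\hat\rho_{ij}\hat\gamma_j,$$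 $$\hat\rho_{ij}=\sum_{\ell=1}^{k_1}\hat b_\ell P_i(\hat c_\ell)P_j(\hat c_\ell)S(u(\hat c_\ell h)),\qquad \hat\gamma_j=\sum_{\ell=1}^{k_2}b_\ell P_j(c_\ell)\nabla H(u(c_\ell h)),\qquad i,j=0,\dots,s-1,$$ and sets $y_1:=u(h)=y_0+h\hat\Gamma_0$. The polynomial $u=u_h$ depends on $h$; for the asymptotic statement, for all sufficiently small $h>0$ it is taken to be a solution of its defining equations whose values on $[0,h]$ remain in a fixed compact neighborhood of $y_0$ on which $S$ and $H$ are smooth. The $O(\cdot)$ symbol refers to $h\to0^+$ with everything else fixed. *)

(* Defs.v *)
From HB Require Import structures.
From mathcomp Require Import all_boot all_order all_algebra.
From mathcomp Require Import all_classical all_reals all_analysis.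
From mathcomp Require Import(canonicals,coercions) mpoly.

Set Implicit Arguments.
Unset Strict Implicit.
Unset Printing Implicit Defensive.
Import Order.TTheory GRing.Theory Num.Theory.
Import numFieldNormedType.Exports.

Local Open Scope classical_set_scope.
Local Open Scope ring_scope.

Section Smoothness.
Variables (R : realType) (m : nat).

Definition partial (i : 'I_m) (f : 'cV[R]_m -> R) : 'cV[R]_m -> R :=
  fun y => 'D_(delta_mx i 0) f y.

Definition grad (f : 'cV[R]_m -> R) : 'cV[R]_m -> 'cV[R]_m :=
  fun y => \col_i partial i f y.

(* [U] is meant to be open, so that the partial derivatives at points of [U]
   depend only on the values of [f] on [U]. *)
Fixpoint Cn_on (n : nat) (U : set 'cV[R]_m) (f : 'cV[R]_m -> R) : Prop :=
  match n with
  | 0 => forall y, U y -> {for y, continuous f}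
  | n'.+1 => (forall y, U y -> differentiable f y) /\
             forall i, Cn_on n' U (partial i f)
  end.

Definition smooth_on (U : set 'cV[R]_m) (f : 'cV[R]_m -> R) : Prop :=
  forall n, Cn_on n U f.

(* [mpoly.msize p] is the total degree of [p] plus one, and 0 for [p = 0]. *)
Definition poly_fun_le (nu : nat) (f : 'cV[R]_m -> R) : Prop :=
  exists p : mpoly.mpoly m R, (mpoly.msize p <= nu.+1)%N /\
    forall y, f y = mpoly.meval (fun i => y i 0) p.

End Smoothness.

Section Quadrature.
Variable R : realType.

(* These conditions determine each [P i], [i > 0], up to its sign, which is
   immaterial below. *)
Definition orthonormal_legendre (P : nat -> {poly R}) : Prop :=
  [/\ P 0 = 1,
      forall i, size (P i) = i.+1 &
      forall i j, \int[lebesgue_measure]_(x in `[0, 1]) ((P i).[x] * (P j).[x])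
                  = (i == j)%:R].

Definition lagrange_poly (k : nat) (c : 'I_k -> R) (l : 'I_k) : {poly R} :=
  \prod_(j < k | j != l) ((c l - c j)^-1 *: ('X - (c j)%:P)).

(* Interpolatory quadrature on [0, 1] at the [k] zeros of the Legendre
   polynomial of degree [k]; the numbering of the nodes is arbitrary. *)
Definition gauss_legendre (P : nat -> {poly R}) (k : nat)
    (c b : 'I_k -> R) : Prop :=
  [/\ injective c,
      forall l, root (P k) (c l) &
      forall l, b l =
        \int[lebesgue_measure]_(x in `[0, 1]) (lagrange_poly c l).[x]].

End Quadrature.

Section LIM.
Variables (R : realType) (m : nat).

Definition vhorner (u : 'cV[{poly R}]_m) (t : R) : 'cV[R]_m :=
  \col_i (u i 0).[t].

Variables (P : nat -> {poly R}) (k1 k2 s : nat).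
Variables (ch bh : 'I_k1 -> R) (c b : 'I_k2 -> R).
Variables (S : 'cV[R]_m -> 'M[R]_m) (H : 'cV[R]_m -> R) (y0 : 'cV[R]_m).
Variables (h : R) (u : 'cV[{poly R}]_m).

Definition rho_hat (i j : nat) : 'M[R]_m :=
  \sum_(l < k1) (bh l * (P i).[ch l] * (P j).[ch l]) *: S (vhorner u (ch l * h)).

Definition gamma_hat (j : nat) : 'cV[R]_m :=
  \sum_(l < k2) (b l * (P j).[c l]) *: grad H (vhorner u (c l * h)).

Definition Gamma_hat (i : nat) : 'cV[R]_m :=
  \sum_(j < s) rho_hat i j *m gamma_hat j.

Definition LIM_solution : Prop :=
  (forall i, (size (u i 0%R) <= s.+1)%N) /\
  forall t : R, 0 <= t <= 1 ->
    vhorner u (t * h) =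
    y0 + h *: \sum_(i < s)
                (\int[lebesgue_measure]_(x in `[0, t]) (P i).[x]) *: Gamma_hat i.

End LIM.

(* Main.v *)
Require Import Defs.
From HB Require Import structures.
From mathcomp Require Import all_boot all_order all_algebra.
From mathcomp Require Import all_classical all_reals all_analysis.
From mathcomp Require Import ring.
From mathcomp Require Import(canonicals,coercions) mpoly.

Set Implicit Arguments.
Unset Strict Implicit.
Unset Printing Implicit Defensive.
Import Order.TTheory GRing.Theory Num.Theory.
Import numFieldNormedType.Exports.

Local Open Scope classical_set_scope.
Local Open Scope ring_scope.

(** Put [w t := u (t * h)] and [G := H o w]. Skew-symmetry of [S] makes the
    [k2]-point Gauss quadrature of [G' = grad H (w) . w'] vanish, so
    [H y1 - H y0 = \int_0^1 G'] is a quadrature error. If [H] has degree [nu]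
    with [nu * s <= 2 * k2], then [G'] has degree less than [2 * k2] and the
    error is zero. In general it is [O(h^(2 k2 + 1))] as soon as
    [G^(n) = O(h^n)] for [n <= 2 k2 + 1], hence as soon as [w^(n) = O(h^n)].
    This is shown by bootstrapping: if [w^(n) = O(h^n)] for [n <= r], then
    [f o w], for [f] smooth, is a polynomial of degree less than [q] up to
    [O(h^q)], for every [q <= r]; since Gauss quadrature inherits the
    orthogonality of the [P j], this gives [gamma_j = O(h^min(j,r))] and
    [rho_ij = O(h^min(i-j,r))], hence [Gamma_i = O(h^min(i,r))]. As
    [w' = h * \sum_i Gamma_i P_i], it follows that [w^(n) = O(h^n)] for
    [n <= r + 1]. *)

(** * Integration of polynomials on [0, 1] through formal primitives *)

Section PolynomialIntegral.
Variable R : realType.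
Implicit Types (p q : {poly R}) (t : R).

(* The coefficient of index 0 is [p`_0 / 0 = 0]. *)
Definition primitive p : {poly R} := \poly_(i < (size p).+1) (p`_i.-1 / i%:R).

Lemma coef_primitive p i : (primitive p)`_i = p`_i.-1 / i%:R.
Proof.
rewrite coef_poly; case: ltnP => // szi.
by case: i szi => // i /ltnSE szi /=; rewrite nth_default// mul0r.
Qed.

Lemma deriv_primitive p : (primitive p)^`() = p.
Proof.
apply/polyP => i; rewrite coef_deriv coef_primitive /=.
by rewrite -[_ *+ _]mulr_natr divfK// pnatr_eq0.
Qed.

Lemma primitive0 p : (primitive p).[0] = 0.
Proof. by rewrite horner_coef0 coef_primitive invr0 mulr0. Qed.

Lemma size_primitive p : (size (primitive p) <= (size p).+1)%N.
Proof. exact: size_poly. Qed.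

Lemma primitive_is_linear : linear primitive.
Proof.
move=> a p q; apply/polyP => i.
by rewrite coefD coefZ !coef_primitive coefD coefZ mulrDl mulrA.
Qed.

Definition integral01 p : R := (primitive p).[1].

Lemma integral01_is_linear : linear_for *%R integral01.
Proof. by move=> a p q; rewrite /integral01 primitive_is_linear !hornerE. Qed.

HB.instance Definition _ :=
  GRing.isLinear.Build R {poly R} R *%R integral01 integral01_is_linear.

(** Replaces the Lebesgue integrals of the definitions by algebraic expressions. *)
Lemma Rintegral_horner p t : 0 <= t ->
  \int[lebesgue_measure]_(x in `[0, t]) p.[x] = (primitive p).[t].
Proof.
(* The fundamental theorem of calculus is applied on a nondegenerate interval, so [t = 0] is treated
   apart. *)
rewrite le_eqVlt => /predU1P[<-|t0].
  by rewrite set_itv1 Rintegral_set1 primitive0.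
rewrite /Rintegral (@continuous_FTC2 _ _ (horner (primitive p)))//.
- by rewrite primitive0 sube0.
- by apply: continuous_in_subspaceT => x ?; exact: continuous_horner.
- split.
  + by move=> x _; exact: derivable_horner.
  + by apply: cvg_at_right_filter; exact: continuous_horner.
  + by apply: cvg_at_left_filter; exact: continuous_horner.
- by move=> x _; rewrite -derivE deriv_primitive.
Qed.

Lemma integral01_Rintegral p :
  \int[lebesgue_measure]_(x in `[0, 1]) p.[x] = integral01 p.
Proof. exact: Rintegral_horner. Qed.

Lemma horner_mvt p (a b : R) : a < b ->
  exists2 x, x \in `]a, b[ & p.[b] - p.[a] = p^`().[x] * (b - a).
Proof.
move=> ab; apply: MVT => //.
by apply: continuous_in_subspaceT => x ?; exact: continuous_horner.
Qed.

(** The primitive is nondecreasing on [0, 1]. If it were 0 at both ends, it would vanish in between,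
    hence be the zero polynomial, and so would its derivative [p]. *)
Lemma integral01_gt0 p : p != 0 -> (forall x, 0 < x < 1 -> 0 <= p.[x]) ->
  0 < integral01 p.
Proof.
move=> p0 p_ge0.
have incr a b : 0 <= a -> a < b -> b <= 1 ->
    (primitive p).[a] <= (primitive p).[b].
  move=> a0 ab b1; rewrite -subr_ge0.
  have [x] := horner_mvt (primitive p) ab.
  rewrite in_itv/= => /andP[ax xb] ->; rewrite deriv_primitive.
  rewrite mulr_ge0 ?subr_ge0 ?(ltW ab)// p_ge0//.
  by rewrite (le_lt_trans a0 ax) (lt_le_trans xb b1).
rewrite lt_neqAle; apply/andP; split; last first.
  by rewrite -(primitive0 p); exact: incr.
apply/eqP => I0.
have cst x : 0 < x < 1 -> (primitive p).[x] = 0.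
  move=> /andP[x0 x1]; apply/eqP; rewrite eq_le.
  have := incr _ _ (lexx 0) x0 (ltW x1); have := incr _ _ (ltW x0) x1 (lexx 1).
  by rewrite primitive0 -/(integral01 p) -I0 => -> ->.
have : primitive p = 0.
  apply/eqP/negPn/negP => pp0.
  (* The points 1/2, 1/3, ... of the open interval are roots, and as many are taken as the size of
     the primitive: one too many. *)
  pose rs := [seq (i.+2)%:R^-1 : R | i <- iota 0 (size (primitive p))].
  have: (size rs < size (primitive p))%N.
    apply: max_poly_roots => //.
      apply/allP => _ /mapP[i _ ->]; apply/eqP/cst.
      by rewrite invr_gt0 ltr0n/= invf_lt1 ?ltr0n// ltr1n.
    rewrite map_inj_uniq ?iota_uniq// => i j /invr_inj /eqP.
    by rewrite eqr_nat => /eqP[].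
  by rewrite size_map size_iota ltnn.
by move=> pp; move: p0; rewrite -(deriv_primitive p) pp deriv0 eqxx.
Qed.

End PolynomialIntegral.

(** * Orthogonality of Legendre polynomials and exactness of Gauss quadrature *)

Section Legendre.
Variables (R : realType) (P : nat -> {poly R}).
Hypothesis hP : orthonormal_legendre P.

Lemma integral01_legendre i j : integral01 (P i * P j) = (i == j)%:R.
Proof.
have [_ _ <-] := hP; rewrite -integral01_Rintegral.
by apply: eq_Rintegral => x _; rewrite hornerM.
Qed.

Lemma size_legendre i : size (P i) = i.+1.
Proof. by have [_ + _] := hP; apply. Qed.

Lemma legendre_neq0 i : P i != 0.
Proof. by rewrite -size_poly_eq0 size_legendre. Qed.

(** Strong induction on the size of [p]: with [d] the degree of [p], a multiple of [P d] cancels the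
    leading term, and [P d] is itself orthogonal to [P j] since [d < j]. *)
Lemma legendre_orthogonal j (p : {poly R}) :
  (size p <= j)%N -> integral01 (p * P j) = 0.
Proof.
have [n] := ubnP (size p); elim: n => // n IH in p * => /ltnSE pn pj.
have [->|p0] := eqVneq p 0; first by rewrite mul0r raddf0.
have sp := prednK (etrans (lt0n _) (etrans (congr1 negb (size_poly_eq0 p)) p0)).
set d := (size p).-1 in sp.
have d_ltj : (d < j)%N by rewrite sp.
have lP : lead_coef (P d) != 0 by rewrite lead_coef_eq0 legendre_neq0.
set a := lead_coef p / lead_coef (P d).
have -> : p = (p - a *: P d) + a *: P d by rewrite subrK.
have I0 : integral01 (a *: P d * P j) = 0.
  by rewrite -scalerAl linearZ/= integral01_legendre (ltn_eqF d_ltj) mulr0.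
rewrite mulrDl raddfD/= I0 addr0.
have small : (size (p - a *: P d)%R < size p)%N.
  rewrite -sp ltnS; apply/leq_sizeP => k; rewrite leq_eqVlt => /predU1P[<-|dk].
    rewrite coefB coefZ /a !lead_coefE size_legendre/= divfK ?subrr//.
    by move: lP; rewrite lead_coefE size_legendre.
  rewrite coefB coefZ !nth_default ?size_legendre//; last by rewrite -sp.
  by rewrite mulr0 subrr.
apply: IH; first exact: leq_trans small pn.
exact: ltnW (leq_trans small pj).
Qed.

Variables (k : nat) (c b : 'I_k -> R).
Hypothesis hGL : gauss_legendre P c b.

(* Outside of [0, 1], [c l] would give [P k ^ 2 / ('X - (c l)%:P)] constant sign
   on [0, 1], whereas its integral is 0 by orthogonality. *)
Lemma gauss_node_itv l : 0 <= c l <= 1.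
Proof.
have [_ /(_ l) rootc _] := hGL.
have [q Pkq] := factor_theorem (P k) (c l) rootc.
have q0 : q != 0.
  by apply: contra_neq (legendre_neq0 k) => q0; rewrite Pkq q0 mul0r.
have sq : (size q <= k)%N.
  have := size_legendre k; rewrite Pkq size_Mmonic ?monicXsubC// size_XsubC.
  by rewrite addn2/= => -[->].
have := legendre_orthogonal sq; rewrite Pkq mulrA => I0.
have [|cl0] := leP 0 (c l); [have [//|cl1 _] := leP (c l) 1|].
- have := @integral01_gt0 _ (- (q * q * ('X - (c l)%:P))).
  rewrite raddfN/= I0 oppr0 ltxx oppr_eq0 !mulf_neq0 ?polyXsubC_eq0//.
  move=> /(_ isT) H; suff: false by [].
  apply: H => x /andP[_ x1]; rewrite !hornerE/= -mulrN mulr_ge0 ?sqr_ge0//.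
  by rewrite oppr_ge0 subr_le0 (le_trans (ltW x1))// ltW.
- have := @integral01_gt0 _ (q * q * ('X - (c l)%:P)).
  rewrite I0 ltxx !mulf_neq0 ?polyXsubC_eq0//.
  move=> /(_ isT) H; suff: false by [].
  apply: H => x /andP[x0 _]; rewrite !hornerE/= mulr_ge0 ?sqr_ge0//.
  by rewrite subr_ge0 ltW// (lt_trans cl0).
Qed.

(** The difference of the two sides has size at most [k] but vanishes at the [k] distinct nodes. *)
Lemma lagrange_interpolation (p : {poly R}) : (size p <= k)%N ->
  p = \sum_l p.[c l] *: lagrange_poly c l.
Proof.
have [cinj _ _] := hGL => pk.
have slag l : (size (lagrange_poly c l) <= k)%N.
  rewrite /lagrange_poly; apply: leq_trans (size_poly_prod_leq _ _) _.
  rewrite (eq_bigr (fun=> 2%N)) => [|j jl]; last first.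
    by rewrite size_scale ?size_XsubC// invr_eq0 subr_eq0 eq_sym (inj_eq cinj).
  rewrite sum_nat_const cardC1 card_ord.
  have k0 : (0 < k)%N by apply: leq_ltn_trans (ltn_ord l).
  by rewrite leq_subLR muln2 -addnn -[in leqRHS](prednK k0) addnS.
apply/eqP; rewrite -subr_eq0; apply/negPn/negP => d0.
have: (size [seq c l | l <- enum 'I_k] <
       size (p - \sum_l p.[c l] *: lagrange_poly c l)%R)%N.
  apply: max_poly_roots => //; last first.
    by rewrite map_inj_uniq ?enum_uniq.
  apply/allP => _ /mapP[l _ ->]; rewrite /root !hornerE horner_sum (bigD1 l)//=.
  rewrite big1 ?addr0 => [|j jl].
    rewrite hornerZ horner_prod big1 ?mulr1 ?subrr// => j jl.
    by rewrite !hornerE mulVf// subr_eq0 eq_sym (inj_eq cinj).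
  rewrite hornerZ horner_prod; apply/eqP; rewrite mulf_eq0; apply/orP; right.
  by apply/prodf_eq0; exists l; rewrite 1?eq_sym// !hornerE subrr mulr0.
rewrite size_map size_enum_ord ltnNge => /negP; apply.
apply: (leq_trans (size_polyD _ _)); rewrite geq_max pk size_polyN.
apply: (leq_trans (size_sum _ _ _)); apply/bigmax_leqP => l _.
exact: leq_trans (size_scale_leq _ _) (slag l).
Qed.

(** Euclidean division by [P k]: the multiple of [P k] vanishes at the nodes and has integral 0 by
    orthogonality, the quotient having size at most [k]; the remainder is integrated exactly because
    the weights are interpolatory. *)
Lemma gauss_exact (p : {poly R}) : (size p <= 2 * k)%N ->
  \sum_l b l * p.[c l] = integral01 p.
Proof.
have [cinj rootc bE] := hGL => pk.
have bI l : b l = integral01 (lagrange_poly c l).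
  by rewrite bE integral01_Rintegral.
have Pk0 := legendre_neq0 k.
have sr : (size (p %% P k)%R <= k)%N.
  by rewrite -ltnS -(size_legendre k) ltn_modp.
have sq : (size (p %/ P k)%R <= k)%N.
  by rewrite size_divp// size_legendre/= leq_subLR addnn -mul2n.
rewrite [in RHS](divp_eq p (P k)) raddfD/= legendre_orthogonal// add0r.
rewrite (lagrange_interpolation sr) raddf_sum/=; apply: eq_bigr => l _.
rewrite linearZ/= bI mulrC [in LHS](divp_eq p (P k)) !hornerE.
by rewrite (rootP (rootc l)) mulr0 add0r.
Qed.

End Legendre.

(** * Chain rule along a curve given by its coordinates *)

Section ChainRule.
Variables (R : realType) (m : nat).

(** The velocity of the curve is expanded in the basis [delta_mx i 0], and the differential of [f]
    is linear. *)
Lemma is_derive_col_comp (f : 'cV[R]_m -> R) (x : 'I_m -> R -> R)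
    (dx : 'I_m -> R) (t : R) :
  (forall i, is_derive t 1 (x i) (dx i)) ->
  differentiable f (\col_i x i t) ->
  is_derive t 1 (fun t => f (\col_i x i t))
    (\sum_i partial i f (\col_i x i t) * dx i).
Proof.
move=> xdx df; pose g (t : R) : 'cV[R]_m := \col_i x i t.
have gij i j : (fun t => g t i j) = x i by apply/funext => z; rewrite mxE.
have dg : derivable g t 1.
  by apply/derivable_mxP => i j; rewrite gij; apply: ex_derive.
have gdiff : differentiable g t by apply/derivable1_diffP.
have fgdiff : differentiable (f \o g) t by exact: differentiable_comp.
apply: DeriveDef; first exact/diff_derivable.
rewrite (deriveE _ fgdiff) diff_comp//= -(deriveE _ gdiff) derive_mx//.
under eq_mx do rewrite gij derive_val.
rewrite [X in 'd _ _ X](_ : _ = \sum_i dx i *: delta_mx i 0); last first.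
  apply/colP => i; rewrite mxE summxE (bigD1 i)//= big1 ?addr0 => [|j ji].
    by rewrite !mxE !eqxx mulr1.
  by rewrite !mxE eq_sym (negbTE ji) mulr0.
rewrite linear_sum; apply: eq_bigr => i _.
by rewrite linearZ/= /partial deriveE// mulrC.
Qed.

End ChainRule.

(** * Calculus of bounds in powers of [h], uniform on [0, 1] *)

Section UniformBigO.
Variable R : realType.
Implicit Types (phi psi : R -> R -> R) (a b n : nat).

(** One constant serves all [t]; a quantity depending on [h] alone is represented with a dummy
    second argument. *)
Definition unif_bigO a phi : Prop :=
  exists C : R, \forall h \near 0^'+,
    forall t : R, 0 <= t <= 1 -> `|phi h t| <= C * h ^+ a.

(* The [j]-th derivative of [phi h t] in [t] is [O(h ^ (a + j))], [j <= n]. *)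
Fixpoint deriv_bigO n a phi : Prop :=
  unif_bigO a phi /\
  match n with
  | 0 => True
  | n'.+1 => exists dphi : R -> R -> R,
      (\forall h \near 0^'+, forall t : R, 0 <= t <= 1 ->
         is_derive t 1 (phi h) (dphi h t)) /\
      deriv_bigO n' a.+1 dphi
  end.

Lemma unif_bigO_ext a phi psi : (forall h t, psi h t = phi h t) ->
  unif_bigO a phi -> unif_bigO a psi.
Proof.
by move=> e; rewrite (_ : psi = phi)//; apply/funext => h; apply/funext => t.
Qed.

Lemma deriv_bigO_ext n a phi psi : (forall h t, psi h t = phi h t) ->
  deriv_bigO n a phi -> deriv_bigO n a psi.
Proof.
by move=> e; rewrite (_ : psi = phi)//; apply/funext => h; apply/funext => t.
Qed.

Lemma unif_bigO_cst (x : R) : unif_bigO 0 (fun _ _ => x).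
Proof. by exists `|x|; apply: nearW => h t _; rewrite expr0 mulr1. Qed.

Lemma unif_bigO0 a : unif_bigO a (fun _ _ => 0).
Proof. by exists 0; apply: nearW => h t _; rewrite normr0 mul0r. Qed.

Lemma unif_bigO_id : unif_bigO 1 (fun h _ => h).
Proof.
by exists 1; near=> h => t _; rewrite expr1 mul1r ger0_norm.
Unshelve. all: by end_near. Qed.

Lemma unif_bigOD a phi psi : unif_bigO a phi -> unif_bigO a psi ->
  unif_bigO a (fun h t => phi h t + psi h t).
Proof.
move=> [C hC] [D hD]; exists (C + D); near=> h => t t01.
rewrite mulrDl (le_trans (ler_normD _ _))// lerD//; move: t t01; near: h.
  exact: hC.
exact: hD.
Unshelve. all: by end_near. Qed.

Lemma unif_bigOM a b phi psi : unif_bigO a phi -> unif_bigO b psi ->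
  unif_bigO (a + b) (fun h t => phi h t * psi h t).
Proof.
move=> [C hC] [D hD]; exists (C * D); near=> h => t t01.
rewrite exprD mulrACA normrM ler_pM//; move: t t01; near: h.
  exact: hC.
exact: hD.
Unshelve. all: by end_near. Qed.

Lemma unif_bigOW a b phi : (a <= b)%N -> unif_bigO b phi -> unif_bigO a phi.
Proof.
(* The definition does not make [C] nonnegative, hence the absolute value. *)
move=> ab [C hC]; exists `|C|; near=> h => t t01.
have h0 : 0 <= h by [].
have h1 : h <= 1 by near: h; apply: nbhs_right_le.
apply: (@le_trans _ _ (C * h ^+ b)).
  by move: t t01; near: h; exact: hC.
rewrite (le_trans (ler_norm _))// normrM ler_wpM2l// ger0_norm ?exprn_ge0//.
exact: ler_wiXn2l.
Unshelve. all: by end_near. Qed.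

Lemma unif_bigO_near a phi psi :
  (\forall h \near 0^'+, forall t, 0 <= t <= 1 -> phi h t = psi h t) ->
  unif_bigO a phi -> unif_bigO a psi.
Proof.
move=> pp [C hC]; exists C; near=> h => t t01.
rewrite -(near pp h)//; move: t t01; near: h; exact: hC.
Unshelve. all: by end_near. Qed.

Lemma unif_bigO_sum (I : Type) (r : seq I) (Q : pred I) a
    (F : I -> R -> R -> R) :
  (forall i, Q i -> unif_bigO a (F i)) ->
  unif_bigO a (fun h t => \sum_(i <- r | Q i) F i h t).
Proof.
move=> OF; elim: r => [|i r IH].
  apply: (@unif_bigO_ext _ (fun _ _ => 0)) => [h t|]; first by rewrite big_nil.
  exact: unif_bigO0.
case: (boolP (Q i)) => Qi.
  apply: (@unif_bigO_ext _ (fun h t => F i h t + \sum_(j <- r | Q j) F j h t)).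
    by move=> h t; rewrite big_cons Qi.
  by apply: unif_bigOD => //; exact: OF.
apply: unif_bigO_ext IH => h t; by rewrite big_cons (negbTE Qi).
Qed.

Lemma unif_bigO_eval a phi (t : R) : 0 <= t <= 1 ->
  unif_bigO a phi -> unif_bigO a (fun h _ => phi h t).
Proof. by move=> t01 [C hC]; exists C; apply: filterS hC => h + z _; apply. Qed.

Lemma deriv_bigOS n a phi : deriv_bigO n.+1 a phi -> deriv_bigO n a phi.
Proof.
elim: n a phi => [|n IH] a phi [Ophi [dphi [hd dO]]]; split=> //.
by exists dphi; split=> //; exact: IH.
Qed.

Lemma deriv_bigOW n n' a phi : (n <= n')%N ->
  deriv_bigO n' a phi -> deriv_bigO n a phi.
Proof.
move=> /subnK <-; elim: (n' - n)%N => [//|k IH].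
by rewrite addSn => /deriv_bigOS.
Qed.

Lemma deriv_bigO0 n a : deriv_bigO n a (fun _ _ => 0).
Proof.
elim: n a => [|n IH] a; split=> //; [exact: unif_bigO0|exact: unif_bigO0|].
exists (fun _ _ => 0); split; last exact: IH.
by apply: nearW => h t _; exact: is_derive_cst.
Qed.

Lemma deriv_bigOD n a phi psi : deriv_bigO n a phi -> deriv_bigO n a psi ->
  deriv_bigO n a (fun h t => phi h t + psi h t).
Proof.
elim: n a phi psi => [|n IH] a phi psi [Ophi dphi] [Opsi dpsi].
  by split=> //; exact: unif_bigOD.
split; first exact: unif_bigOD.
move: dphi dpsi => [dphi [hphi phiO]] [dpsi [hpsi psiO]].
exists (fun h t => dphi h t + dpsi h t); split; last exact: IH.
apply: filterS2 hphi hpsi => h hp hq t t01.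
by apply: (@is_deriveD _ _ _ (phi h) (psi h)); [exact: hp|exact: hq].
Qed.

Lemma deriv_bigO_sum (I : Type) (r : seq I) (Q : pred I) n a
    (F : I -> R -> R -> R) :
  (forall i, Q i -> deriv_bigO n a (F i)) ->
  deriv_bigO n a (fun h t => \sum_(i <- r | Q i) F i h t).
Proof.
move=> OF; elim: r => [|i r IH].
  apply: (@deriv_bigO_ext _ _ (fun _ _ => 0)) => [h t|].
    by rewrite big_nil.
  exact: deriv_bigO0.
case: (boolP (Q i)) => Qi.
  apply: (@deriv_bigO_ext _ _
      (fun h t => F i h t + \sum_(j <- r | Q j) F j h t)).
    by move=> h t; rewrite big_cons Qi.
  by apply: deriv_bigOD => //; exact: OF.
apply: deriv_bigO_ext IH => h t; by rewrite big_cons (negbTE Qi).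
Qed.

(** By the product rule, each differentiation raises the exponent of exactly one factor, so [a + b]
    increases by one in both terms. *)
Lemma deriv_bigOM n a b phi psi : deriv_bigO n a phi -> deriv_bigO n b psi ->
  deriv_bigO n (a + b) (fun h t => phi h t * psi h t).
Proof.
elim: n a b phi psi => [|n IH] a b phi psi dphi dpsi.
  by split=> //; apply: unif_bigOM; [case: dphi|case: dpsi].
have := deriv_bigOS dphi; have := deriv_bigOS dpsi.
move: dphi dpsi => [Ophi [dphi [hphi phiO]]] [Opsi [dpsi [hpsi psiO]]].
move=> psin phin.
split; first exact: unif_bigOM.
exists (fun h t => phi h t * dpsi h t + dphi h t * psi h t); split.
  apply: filterS2 hphi hpsi => h hp hq t t01.
  apply: is_derive_eq.
    by apply: (@is_deriveM _ _ (phi h) (psi h)); [exact: hp|exact: hq].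
  by rewrite [_ *: dphi _ _]mulrC.
by apply: deriv_bigOD; [rewrite -addnS|rewrite -addSn]; exact: IH.
Qed.

Lemma horner_bounded01 (p : {poly R}) :
  exists C, forall t : R, 0 <= t <= 1 -> `|p.[t]| <= C.
Proof.
exists (\sum_(i < size p) `|p`_i|) => t /andP[t0 t1].
rewrite horner_coef (le_trans (ler_norm_sum _ _ _))//; apply: ler_sum => i _.
by rewrite normrM ler_piMr// normrX ger0_norm// exprn_ile1.
Qed.

(** Differentiating [p] gains no power of [h], so the coefficient [x h] must supply [h ^+ (a + q)]
    for each order [q] at which the derivative of [p] can be nonzero. *)
Lemma deriv_bigO_poly n a (x : R -> R) (p : {poly R}) :
  (forall q, (q <= n)%N -> (q < size p)%N ->
    unif_bigO (a + q) (fun h _ => x h)) ->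
  deriv_bigO n a (fun h t => x h * p.[t]).
Proof.
(* For [p = 0] the hypothesis is empty, but the product is 0. *)
have [-> _|] := eqVneq p 0.
  by apply: deriv_bigO_ext (deriv_bigO0 n a) => h t; rewrite horner0 mulr0.
rewrite -size_poly_gt0.
have bp (q : {poly R}) b :
    unif_bigO b (fun h _ => x h) -> unif_bigO b (fun h t => x h * q.[t]).
  move=> Ox; rewrite -[b]addn0; apply: unif_bigOM => //.
  have [C hC] := horner_bounded01 q; exists C; apply: nearW => h t t01.
  by rewrite expr0 mulr1 hC.
elim: n a p => [|n IH] a p p0 Ox.
  by split=> //; apply: bp => //; rewrite -[a]addn0; exact: Ox.
split; first by apply: bp => //; rewrite -[a]addn0; exact: Ox.
exists (fun h t => x h * p^`().[t]); split.
  apply: nearW => h t _; have ? := is_derive_poly p t.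
  exact: (@is_deriveZ _ _ _ (horner p) (x h)).
have [->|dp0] := eqVneq p^`() 0.
  by apply: deriv_bigO_ext (deriv_bigO0 n a.+1) => h t; rewrite horner0 mulr0.
apply: IH; first by rewrite size_poly_gt0.
move=> q qn qp; rewrite addSnnS; apply: Ox => //.
by apply: (leq_ltn_trans qp); rewrite lt_size_deriv// -size_poly_gt0.
Qed.

(** The approximation of the derivative, given by induction, is integrated from 0. As [t <= 1], the
    mean value theorem carries the remainder bound over with the same constant. *)
Lemma deriv_bigO_taylor n a phi : deriv_bigO n a phi ->
  exists p : R -> {poly R}, (forall h, (size (p h) <= n)%N) /\
    unif_bigO (a + n) (fun h t => phi h t - (p h).[t]).
Proof.
elim: n a phi => [|n IH] a phi.
  move=> [Ophi _]; exists (fun=> 0); split=> [h|]; first by rewrite size_poly0.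
  by rewrite addn0; apply: unif_bigO_ext Ophi => h t; rewrite horner0 subr0.
move=> [Ophi [dphi [hphi /IH[q [sq [C hC]]]]]].
pose p h := (phi h 0)%:P + primitive (q h).
exists p; split=> [h|].
  rewrite (leq_trans (size_polyD _ _))// geq_max.
  rewrite (leq_trans (size_polyC_leq1 _))//=.
  by rewrite (leq_trans (size_primitive _)) ?ltnS.
exists C; apply: filterS2 hphi hC => h hp hC t /andP[t0 t1].
pose F z := phi h z - (p h).[z].
have dF (z : R) : 0 <= z <= 1 -> is_derive z 1 F (dphi h z - (q h).[z]).
  move=> z01; have ? := hp z z01.
  apply: (@is_deriveB _ _ _ (phi h) (horner (p h))).
  apply: is_derive_eq.
  by rewrite derivD derivC add0r deriv_primitive.
have F0 : F 0 = 0 by rewrite /F /p !hornerE primitive0 addr0 subrr.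
have sub (z : R) : z \in `[0, t] -> 0 <= z <= 1.
  by rewrite in_itv/= => /andP[-> zt]; exact: le_trans zt t1.
have [||z zt] := @MVT_segment _ F (fun z => dphi h z - (q h).[z]) 0 t t0.
- by move=> z /subset_itv_oo_cc /sub /dF.
- apply: derivable_within_continuous => z /sub /dF ?; exact: ex_derive.
rewrite F0 !subr0 -/(F t) => ->; rewrite normrM (ger0_norm t0).
apply: (@le_trans _ _ `|dphi h z - (q h).[z]|); first by rewrite ler_piMr.
by rewrite -addSnnS; apply: hC; exact: sub.
Qed.

(** A combination of nodal values that kills degrees less than [n] sees only the Taylor remainder of
    order [n]. The weights [W] will be Gauss weights times nodal values of Legendre polynomials. *)
Lemma unif_bigO_quadrature (k n r : nat) (c W : 'I_k -> R) phi :
  (n <= r)%N -> (forall l, 0 <= c l <= 1) ->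
  (forall p : {poly R}, (size p <= n)%N -> \sum_l W l * p.[c l] = 0) ->
  deriv_bigO r 0 phi -> unif_bigO n (fun h _ => \sum_l W l * phi h (c l)).
Proof.
move=> nr c01 W0 /(deriv_bigOW nr) /deriv_bigO_taylor[p [sp Op]].
apply: (@unif_bigO_near _
    (fun h _ => \sum_l W l * (phi h (c l) - (p h).[c l]))).
  apply: nearW => h t _; under eq_bigr do rewrite mulrBr.
  by rewrite sumrB W0 ?subr0.
apply: unif_bigO_sum => l _; rewrite -[n]add0n; apply: unif_bigOM.
  exact: unif_bigO_cst.
exact: unif_bigO_eval Op.
Qed.

End UniformBigO.

(** * The integral of a polynomial derivative *)

Section PolynomialDerivative.
Variable R : realType.

(** The primitive of the derivative of [q], minus [q], has derivative 0; by the mean value theorem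
    it takes the same value at 0 and 1. *)
Lemma integral01_deriv (q : {poly R}) : integral01 q^`() = q.[1] - q.[0].
Proof.
have [z _] := horner_mvt (primitive q^`() - q) (@ltr01 R).
rewrite derivB deriv_primitive subrr horner0 mul0r !hornerE primitive0 add0r.
rewrite -/(integral01 _) opprK => /eqP; rewrite addr_eq0 => /eqP H.
by rewrite -(subrK q.[1] (integral01 _)) H addrC.
Qed.

End PolynomialDerivative.

(** * Smooth functions along paths confined to a compact set *)

Section SmoothComposition.
Variables (R : realType) (m : nat) (U K : set 'cV[R]_m).
Hypotheses (cK : compact K) (KU : K `<=` U).

Lemma Cn_on_continuous n (f : 'cV[R]_m -> R) y :
  Cn_on n U f -> U y -> {for y, continuous f}.
Proof.
case: n => [|n] /=; first exact.
by move=> [df _] Uy; apply: differentiable_continuous; exact: df.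
Qed.

Lemma compact_bounded_image (f : 'cV[R]_m -> R) :
  (forall y, K y -> {for y, continuous f}) ->
  exists C, forall y, K y -> `|f y| <= C.
Proof.
move=> cf.
have /continuous_compact /(_ cK) /compact_bounded[M [_ HM]] :
    {within K, continuous f}.
  by apply: continuous_in_subspaceT => y /set_mem; exact: cf.
exists (M + 1) => y Ky; apply: (HM (M + 1)); first by rewrite ltrDl.
by exists y.
Qed.

Variable x : 'I_m -> R -> R -> R.
Hypothesis xK : \forall h \near 0^'+, forall t : R, 0 <= t <= 1 ->
  K (\col_i x i h t).

Lemma unif_bigO_comp (f : 'cV[R]_m -> R) :
  (forall y, K y -> {for y, continuous f}) ->
  unif_bigO 0 (fun h t => f (\col_i x i h t)).
Proof.
move=> /compact_bounded_image[C hC]; exists C; apply: filterS xK => h xhK t t01.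
by rewrite expr0 mulr1; apply: hC; exact: xhK.
Qed.

(** Induction on [n] through the chain rule: the partial derivatives along the path are controlled
    by induction, and each factor [dx i] brings one power of [h]. Compactness of [K] bounds the
    values. *)
Lemma deriv_bigO_comp n (f : 'cV[R]_m -> R) : Cn_on n U f ->
  (forall i, deriv_bigO n 0 (x i)) ->
  deriv_bigO n 0 (fun h t => f (\col_i x i h t)).
Proof.
have Ocomp k g : Cn_on k U g -> unif_bigO 0 (fun h t => g (\col_i x i h t)).
  by move=> gC; apply: unif_bigO_comp => y /KU; exact: Cn_on_continuous gC.
elim: n f => [|n IH] f fC xO; split=> //; [exact: Ocomp fC|exact: Ocomp fC|].
have [df dfC] := fC.
have /choice[dx hdx] : forall i, exists dxi : R -> R -> R,
    (\forall h \near 0^'+, forall t : R, 0 <= t <= 1 ->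
       is_derive t 1 (x i h) (dxi h t)) /\ deriv_bigO n 1 dxi.
  by move=> i; have [_] := xO i.
exists (fun h t => \sum_i partial i f (\col_i x i h t) * dx i h t); split.
  (* There are finitely many coordinates, so one range of [h] suits them all. *)
  have xdx : \forall h \near 0^'+, forall i, forall t : R, 0 <= t <= 1 ->
       is_derive t 1 (x i h) (dx i h t).
    by apply: filter_forall => i; have [] := hdx i.
  apply: filterS2 xK xdx => h xhK hd t t01.
  apply: (is_derive_col_comp (x := fun i => x i h)) => [i|]; first exact: hd.
  by apply: df; apply: KU; exact: xhK.
apply: deriv_bigO_sum => i _; apply: (@deriv_bigOM _ n 0 1).
  by apply: IH => [|j]; [exact: dfC|exact/deriv_bigOS].
by have [] := hdx i.
Qed.

End SmoothComposition.

(** * Polynomial Hamiltonians along polynomial curves *)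

Section PolynomialHamiltonian.
Variables (R : realType) (m : nat).

(** In the polynomial case the path is not confined to the set where [H] is assumed smooth, so
    differentiability is needed everywhere. *)
Lemma differentiable_meval (p : mpoly.mpoly m R) (y : 'cV[R]_m) :
  differentiable (fun y : 'cV[R]_m => mpoly.meval (fun i => y i 0) p) y.
Proof.
elim/mpoly.mpolyind: p => [|a mn p _ _ dp].
  rewrite (_ : (fun _ => _) = cst 0); first exact: differentiable_cst.
  by apply/funext => z; rewrite mpoly.meval0.
rewrite (_ : (fun _ => _) = (fun z : 'cV[R]_m =>
    a * \prod_i z i 0 ^+ mpoly.fun_of_multinom mn i) +
    (fun y : 'cV[R]_m => mpoly.meval (fun i => y i 0) p)); last first.
  by apply/funext => z; rewrite mpoly.mevalD mpoly.mevalZ mpoly.mevalX.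
apply: differentiableD => //; apply: (@differentiableZ _ _ _
  (fun z : 'cV[R]_m => \prod_i z i 0 ^+ mpoly.fun_of_multinom mn i) a).
elim: (index_enum _) => [|i r IH].
  rewrite (_ : (fun _ => _) = cst 1); first exact: differentiable_cst.
  by apply/funext => z; rewrite big_nil.
rewrite (_ : (fun _ => _) = (fun z : 'cV[R]_m =>
    z i 0 ^+ mpoly.fun_of_multinom mn i) *
    (fun z : 'cV[R]_m => \prod_(j <- r) z j 0 ^+ mpoly.fun_of_multinom mn j));
  last by apply/funext => z; rewrite big_cons.
apply: differentiableM => //; case: (mpoly.fun_of_multinom mn i) => [|k].
  exact: differentiable_cst.
rewrite (_ : (fun _ => _) = (fun z : 'cV[R]_m => z i 0) ^+ k.+1); last first.
  by rewrite exprfctE.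
apply: differentiableX.
exact: differentiable_coord.
Qed.

Lemma meval_curve (nu s : nat) (p : mpoly.mpoly m R) (w : 'I_m -> {poly R}) :
  (mpoly.msize p <= nu.+1)%N -> (forall i, (size (w i) <= s.+1)%N) ->
  exists q : {poly R}, (size q <= (nu * s).+1)%N /\
    forall t, q.[t] = mpoly.meval (fun i => (w i).[t]) p.
Proof.
move=> sp sw.
exists (\sum_(mn <- mpoly.msupp p)
  mpoly.mcoeff mn p *: \prod_i w i ^+ mpoly.fun_of_multinom mn i); split.
  rewrite big_seq.
  apply: (big_ind (fun q : {poly R} => (size q <= (nu * s).+1)%N)).
  - by rewrite size_poly0.
  - by move=> q r sq sr; rewrite (leq_trans (size_polyD _ _))// geq_max sq.
  move=> mn /mpoly.msize_mdeg_lt mnp; apply: (leq_trans (size_scale_leq _ _)).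
  have {sp mnp} : (mpoly.mdeg mn <= nu)%N by rewrite -ltnS (leq_trans mnp).
  rewrite mpoly.mdegE => sp.
  (* The bound is proved with the exact degree of the monomial, which is additive along the
     product. *)
  apply: (@leq_trans ((\sum_i mpoly.fun_of_multinom mn i) * s).+1); last first.
    by rewrite ltnS leq_mul2r sp orbT.
  apply: (big_ind2 (fun (q : {poly R}) d => (size q <= (d * s).+1)%N)).
  - by rewrite size_poly1.
  - move=> q1 d1 q2 d2 s1 s2; apply: (leq_trans (size_polyMleq _ _)).
    have := leq_add s1 s2; rewrite mulnDl addSn addnS.
    by case: (_ + _)%N => //= k; rewrite ltnS.
  - move=> i _; apply: (leq_trans (size_poly_exp_leq _ _)).
    by rewrite ltnS mulnC leq_mul2l -subn1 leq_subLR add1n sw orbT.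
move=> t; rewrite mpoly.mevalE horner_sum; apply: eq_bigr => mn _.
rewrite hornerZ horner_prod; congr (_ * _); apply: eq_bigr => i _.
by rewrite horner_exp.
Qed.

End PolynomialHamiltonian.

(** * The path of the method and its discrete energy balance *)

Section LIMCurve.
Variables (R : realType) (m s k1 k2 : nat) (P : nat -> {poly R}).
Variables (ch bh : 'I_k1 -> R) (c b : 'I_k2 -> R).
Variables (S : 'cV[R]_m -> 'M[R]_m) (H : 'cV[R]_m -> R) (y0 : 'cV[R]_m).

Local Notation Gam := (Gamma_hat P s ch bh c b S H).

(* The path [t |-> u (t * h)], written with the coefficients [Gamma_hat]: [u]
   itself is only known to satisfy its equation for [t] in [0, 1]. *)
Definition lim_curve (h : R) (u : 'cV[{poly R}]_m) (i : 'I_m) : {poly R} :=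
  (y0 i 0)%:P + \sum_(j < s) (h * Gam h u j i 0) *: primitive (P j).

Lemma horner_lim_curve h u i t : (lim_curve h u i).[t] =
  y0 i 0 + \sum_(j < s) h * Gam h u j i 0 * (primitive (P j)).[t].
Proof.
rewrite /lim_curve hornerD hornerC horner_sum; congr (_ + _).
by apply: eq_bigr => j _; rewrite hornerZ.
Qed.

Lemma lim_curveP h u t : LIM_solution P s ch bh c b S H y0 h u -> 0 <= t <= 1 ->
  vhorner u (t * h) = \col_i (lim_curve h u i).[t].
Proof.
move=> [_ uE] t01; rewrite uE//; apply/colP => i.
rewrite !mxE horner_lim_curve summxE mulr_sumr; congr (_ + _).
apply: eq_bigr => j _; have /andP[t0 _] := t01.
by rewrite mxE Rintegral_horner// mulrAC mulrA.
Qed.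

Lemma lim_curve0 h u : \col_i (lim_curve h u i).[0] = y0.
Proof.
apply/colP => i; rewrite mxE horner_lim_curve big1 ?addr0// => j _.
by rewrite primitive0 mulr0.
Qed.

Lemma deriv_lim_curve h u i :
  (lim_curve h u i)^`() = \sum_(j < s) (h * Gam h u j i 0) *: P j.
Proof.
rewrite derivD derivC add0r raddf_sum/=; apply: eq_bigr => j _.
by rewrite derivZ deriv_primitive.
Qed.

Hypothesis Sskew : forall y, S y = - (S y)^T.

(** The scalar coefficients are symmetric in [i] and [j], so the skew-symmetry of [S] passes to the
    block matrix of the [rho_hat]. *)
Lemma rho_hat_skew h u i j : (rho_hat P ch bh S h u i j)^T =
  - rho_hat P ch bh S h u j i.
Proof.
rewrite /rho_hat linear_sum -sumrN; apply: eq_bigr => l _ /=.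
by rewrite linearZ/= [in RHS]Sskew scalerN opprK mulrAC.
Qed.

(** The sum is the quadratic form of the skew block matrix [rho_hat] at the vector of the
    [gamma_hat]. Being 1 by 1, it equals its transpose, which is its opposite. *)
Lemma gamma_Gamma_orthogonal h u :
  \sum_(j < s) ((gamma_hat P c b H h u j)^T *m Gam h u j) = 0.
Proof.
set E := \sum_(j < s) _.
have ET : E^T = - E.
  rewrite /E /Gamma_hat linear_sum/=.
  under eq_bigr do rewrite mulmx_sumr linear_sum/=.
  rewrite exchange_big/= -sumrN; apply: eq_bigr => j _.
  rewrite mulmx_sumr -sumrN; apply: eq_bigr => i _.
  by rewrite !trmx_mul trmxK rho_hat_skew mulmxN mulNmx mulmxA.
apply/matrixP => i j; rewrite !ord1 [RHS]mxE.
have /matrixP/(_ 0 0) := ET; rewrite !mxE => /eqP.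
by rewrite -addr_eq0 -mulr2n mulrn_eq0/= => /eqP.
Qed.

(* The left-hand side is [h * \sum_j gamma_j^T Gamma_j]. *)
Lemma lim_energy h u : (forall l, 0 <= c l <= 1) ->
  LIM_solution P s ch bh c b S H y0 h u ->
  \sum_(l < k2) b l * \sum_i
    partial i H (\col_i (lim_curve h u i).[c l]) * (lim_curve h u i)^`().[c l]
  = 0.
Proof.
move=> c01 hu.
have := gamma_Gamma_orthogonal h u => /matrixP/(_ 0 0).
rewrite summxE mxE => /(congr1 ( *%R h)); rewrite mulr0 mulr_sumr.
apply: etrans.
transitivity (\sum_(l < k2) \sum_i \sum_(j < s) b l *
    (partial i H (vhorner u (c l * h)) * (h * Gam h u j i 0 * (P j).[c l]))).
  apply: eq_bigr => l _; rewrite mulr_sumr. apply: eq_bigr => i _.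
  rewrite -lim_curveP// deriv_lim_curve horner_sum !mulr_sumr.
  by apply: eq_bigr => j _; rewrite hornerZ.
rewrite exchange_big/=; under eq_bigr do rewrite exchange_big/=.
rewrite exchange_big/=; apply: eq_bigr => j _.
rewrite mxE mulr_sumr; apply: eq_bigr => i _.
set g : R := Gam h u j i 0; rewrite mxE /gamma_hat summxE mulr_suml mulr_sumr.
apply: eq_bigr => l _; rewrite !mxE.
ring.
Qed.

Lemma size_lim_curve h u i : orthonormal_legendre P ->
  (size (lim_curve h u i) <= s.+1)%N.
Proof.
move=> hP; rewrite (leq_trans (size_polyD _ _))// geq_max.
rewrite (leq_trans (size_polyC_leq1 _))//=.
apply: (leq_trans (size_sum _ _ _)); apply/bigmax_leqP => j _.
rewrite (leq_trans (size_scale_leq _ _))// (leq_trans (size_primitive _))//.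
by rewrite (size_legendre hP) ltnS.
Qed.

Hypotheses (hP : orthonormal_legendre P) (hGL2 : gauss_legendre P c b).

Lemma is_derive_lim_curve h u t :
  differentiable H (\col_i (lim_curve h u i).[t]) ->
  is_derive t 1 (fun t => H (\col_i (lim_curve h u i).[t]))
    (\sum_i partial i H (\col_i (lim_curve h u i).[t]) *
       (lim_curve h u i)^`().[t]).
Proof.
move=> dH; apply: (is_derive_col_comp (x := fun i => horner (lim_curve h u i))).
exact: dH.
Qed.

Lemma lim_energy_poly nu h u : poly_fun_le nu H -> (nu * s <= 2 * k2)%N ->
  LIM_solution P s ch bh c b S H y0 h u -> H (vhorner u h) = H y0.
Proof.
move=> [p [sp Hp]] nus hu.
have c01 := gauss_node_itv hP hGL2.
have dH y : differentiable H y.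
  rewrite (_ : H = fun y => mpoly.meval (fun i => y i 0) p).
    exact: differentiable_meval.
  by apply/funext => z; rewrite Hp.
have [q [sq qE]] := meval_curve sp (fun i => size_lim_curve h u i hP).
have HE : (fun t => H (\col_i (lim_curve h u i).[t])) = horner q.
  apply/funext => t; rewrite Hp qE; congr mpoly.meval.
  by apply/funext => i; rewrite mxE.
have dq t : q^`().[t] = \sum_i partial i H (\col_i (lim_curve h u i).[t]) *
    (lim_curve h u i)^`().[t].
  have := is_derive_lim_curve (dH (\col_i (lim_curve h u i).[t])).
  rewrite HE => d1; have d2 := is_derive_poly q t.
  by rewrite -(derive_val (is_derive := d1)) (derive_val (is_derive := d2)).
(* The size of [q] is at most [(nu * s).+1]; differentiation lowers it to at most [2 * k2], exactly
   the range of exact quadrature. *)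
have I0 : integral01 q^`() = 0.
  rewrite -(gauss_exact hP hGL2); last first.
    have [->|q0] := eqVneq q 0; first by rewrite deriv0 size_poly0.
    by rewrite -ltnS (leq_trans (lt_size_deriv q0))// (leq_trans sq).
  by rewrite -[RHS](lim_energy c01 hu); apply: eq_bigr => l _; rewrite dq.
have := integral01_deriv q; rewrite I0 -HE lim_curve0 => /esym/eqP.
by rewrite subr_eq0 -lim_curveP ?ler01 ?lexx// mul1r => /eqP.
Qed.

End LIMCurve.

(** * Decay of the Fourier coefficients and the energy error *)

Section Bootstrap.
Variables (R : realType) (m s k1 k2 : nat).
Hypotheses (sk1 : (s <= k1)%N) (sk2 : (s <= k2)%N).
Variables (P : nat -> {poly R}) (ch bh : 'I_k1 -> R) (c b : 'I_k2 -> R).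
Hypotheses (hP : orthonormal_legendre P).
Hypotheses (hGL1 : gauss_legendre P ch bh) (hGL2 : gauss_legendre P c b).
Variables (S : 'cV[R]_m -> 'M[R]_m) (H : 'cV[R]_m -> R) (y0 : 'cV[R]_m).
Variables (U K : set 'cV[R]_m) (u : R -> 'cV[{poly R}]_m).
Hypotheses (Ssmooth : forall i j, smooth_on U (fun y => S y i j))
           (gradHsmooth : forall i, smooth_on U (fun y => grad H y i 0)).
Hypotheses (cK : compact K) (KU : K `<=` U).
Hypothesis uP : \forall h \near 0^'+,
        LIM_solution P s ch bh c b S H y0 h (u h) /\
        forall t : R, 0 <= t <= h -> K (vhorner (u h) t).

Local Notation gam h := (gamma_hat P c b H h (u h)).
Local Notation rho h := (rho_hat P ch bh S h (u h)).
Local Notation Gam h := (Gamma_hat P s ch bh c b S H h (u h)).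
Local Notation w h := (lim_curve s P ch bh c b S H y0 h (u h)).

Lemma lim_curve_near : \forall h \near 0^'+, forall t : R, 0 <= t <= 1 ->
  vhorner (u h) (t * h) = \col_i (w h i).[t].
Proof. by apply: filterS uP => h [hu _] t; exact: lim_curveP. Qed.

Lemma lim_curve_compact : \forall h \near 0^'+, forall t : R, 0 <= t <= 1 ->
  K (\col_i (w h i).[t]).
Proof.
near=> h => t t01; have h0 : 0 < h by near: h; exact: nbhs_right_gt.
have [hu hK] : LIM_solution P s ch bh c b S H y0 h (u h) /\
    forall t : R, 0 <= t <= h -> K (vhorner (u h) t) by near: h.
rewrite -(lim_curveP hu)//; apply: hK; move/andP: t01 => [t0 t1].
by rewrite mulr_ge0 ?ler_piMl// ltW.
Unshelve. all: by end_near. Qed.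

Let x i h t := (w h i).[t].

(** If [p] has size at most [j], then [p * P j] is integrated exactly, as [j < s <= k2], and its
    integral is 0. *)
Lemma gamma_hat_bigO r j i q : (forall i, deriv_bigO r 0 (x i)) ->
  (j < s)%N -> (q <= j)%N -> (q <= r)%N ->
  unif_bigO q (fun h _ => gam h j i 0).
Proof.
move=> xO js qj qr.
have fO := deriv_bigO_comp cK KU lim_curve_compact (gradHsmooth i r) xO.
have c01 := gauss_node_itv hP hGL2.
have W0 (p : {poly R}) : (size p <= q)%N ->
    \sum_l (b l * (P j).[c l]) * p.[c l] = 0.
  move=> pq; rewrite -[RHS](legendre_orthogonal hP (leq_trans pq qj)).
  rewrite -(gauss_exact hP hGL2); last first.
    apply: (leq_trans (size_polyMleq _ _)); rewrite size_legendre// addnS/=.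
    by rewrite mul2n -addnn leq_add// ltnW//
      (leq_ltn_trans _ (leq_trans js sk2))// (leq_trans pq).
  by apply: eq_bigr => l _; rewrite hornerM -mulrA [(P j).[_] * _]mulrC.
apply: unif_bigO_near (unif_bigO_quadrature qr c01 W0 fO).
apply: filterS lim_curve_near => h wE t _.
by rewrite /gamma_hat summxE; apply: eq_bigr => l _; rewrite wE// [in RHS]mxE.
Qed.

(** If [p] has size at most [i - j], then [p * P j] has size at most [i], hence is orthogonal to
    [P i]. The subtraction is truncated: for [i <= j] only boundedness is claimed. *)
Lemma rho_hat_bigO r i j k l q : (forall i, deriv_bigO r 0 (x i)) ->
  (i < s)%N -> (j < s)%N -> (q <= i - j)%N -> (q <= r)%N ->
  unif_bigO q (fun h _ => rho h i j k l).
Proof.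
move=> xO is_ js qij qr.
have fO := deriv_bigO_comp cK KU lim_curve_compact (Ssmooth k l r) xO.
have c01 := gauss_node_itv hP hGL1.
have W0 (p : {poly R}) : (size p <= q)%N ->
    \sum_l (bh l * (P i).[ch l] * (P j).[ch l]) * p.[ch l] = 0.
  (* A nonzero [p] forces [j < i], so the subtraction is then a true one. *)
  have [->|p0 pq] := eqVneq p 0.
    by move=> _; rewrite big1// => n _; rewrite horner0 mulr0.
  have pji : (size (p * P j)%R <= i)%N.
    rewrite (leq_trans (size_polyMleq _ _))// size_legendre// addnS/=.
    move: (leq_trans pq qij); have : (0 < size p)%N by rewrite size_poly_gt0.
    by move=> sp0 spij; rewrite -(@subnK j i) ?leq_add2r// ltnW// -subn_gt0
      (leq_trans sp0).
  rewrite -[RHS](legendre_orthogonal hP pji) -(gauss_exact hP hGL1); last first.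
    apply: (leq_trans (size_polyMleq _ _)); rewrite size_legendre// addnS/=.
    have ik := ltnW (leq_trans is_ sk1).
    by rewrite mul2n -addnn leq_add// (leq_trans pji).
  apply: eq_bigr => n _; rewrite !hornerM; ring.
apply: unif_bigO_near (unif_bigO_quadrature qr c01 W0 fO).
apply: filterS lim_curve_near => h wE t _.
by rewrite /rho_hat summxE; apply: eq_bigr => n _; rewrite wE// [in RHS]mxE.
Qed.

(** In the term of index [n], if [q <= n] then [gamma_hat] alone has order [q]; otherwise it has
    order [n] and [rho_hat] supplies the missing [q - n <= j - n]. *)
Lemma Gamma_hat_bigO r j i q : (forall i, deriv_bigO r 0 (x i)) ->
  (j < s)%N -> (q <= j)%N -> (q <= r)%N ->
  unif_bigO q (fun h _ => Gam h j i 0).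
Proof.
move=> xO js qj qr.
apply: (@unif_bigO_ext _ _ (fun h _ => \sum_(n < s) \sum_k
    rho h j n i k * gam h n k 0)).
  by move=> h t; rewrite /Gamma_hat summxE; apply: eq_bigr => n _; rewrite mxE.
apply: unif_bigO_sum => n _; apply: unif_bigO_sum => k _.
have [qn|/ltnW nq] := leqP q n.
  apply: (@unif_bigOM _ 0 q); first exact: (rho_hat_bigO _ _ xO).
  exact: (gamma_hat_bigO _ xO).
rewrite -(subnK nq); apply: unif_bigOM.
  apply: (rho_hat_bigO _ _ xO) => //; first exact: leq_sub2r.
  by rewrite (leq_trans (leq_subr _ _)).
by apply: (gamma_hat_bigO _ xO) => //; exact: leq_trans qr.
Qed.

(* Order [r] bounds on the Fourier coefficients [Gamma_j] give order [r + 1]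
   bounds on the path, thanks to the factor [h] in front of [Gamma_j]. *)
Lemma lim_curve_bigO r i : deriv_bigO r 0 (x i).
Proof.
elim: r i => [|r IH] i.
  (* At order 0 the path is bounded because it stays in the compact [K]. *)
  split=> //; apply: unif_bigO_ext (unif_bigO_comp cK lim_curve_compact
    (f := fun y => y i 0) _) => [h t|y _]; first by rewrite mxE.
  exact/differentiable_continuous/differentiable_coord.
apply: (@deriv_bigO_ext _ _ _ (fun h t => y0 i 0 * (1 : {poly R}).[t] +
    \sum_(j < s) h * Gam h j i 0 * (primitive (P j)).[t])).
  by move=> h t; rewrite hornerC mulr1 /x horner_lim_curve.
apply: deriv_bigOD.
  apply: (@deriv_bigO_poly _ _ 0 (fun=> y0 i 0)) => q _.
  by rewrite size_poly1 ltnS leqn0 => /eqP ->; exact: unif_bigO_cst.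
apply: deriv_bigO_sum => j _.
apply: (@deriv_bigO_poly _ _ 0 (fun h => h * Gam h j i 0)) => q qr.
move=> /leq_trans/(_ (size_primitive _)); rewrite size_legendre// ltnS => qj.
(* The predecessor is truncated: for [q = 0] the order 1 obtained is weakened to 0. *)
apply: (@unif_bigOW _ _ (1 + q.-1)); first by rewrite add1n leqSpred.
apply: unif_bigOM; first exact: unif_bigO_id.
by apply: (Gamma_hat_bigO _ IH) => //; rewrite -subn1 leq_subLR add1n.
Qed.

Hypothesis Sskew : forall y, S y = - (S y)^T.
Hypothesis Hdiff : forall y, U y -> differentiable H y.

(** The derivative of [H] along the path is a polynomial [p h] of size at most [2 * k2] plus a
    remainder of order [1 + 2 * k2]. The integral of the remainder is bounded by the mean value
    theorem, that of [p h] through quadrature. *)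
Lemma lim_energy_bigO :
  unif_bigO (2 * k2 + 1) (fun h _ => H (vhorner (u h) h) - H y0).
Proof.
have HC : Cn_on (2 * k2).+1 U H.
  split=> // i; have := gradHsmooth i (2 * k2).
  by under eq_fun do rewrite mxE.
have c01 := gauss_node_itv hP hGL2.
have [_ [dG [hdG]]] := deriv_bigO_comp cK KU lim_curve_compact HC
  (lim_curve_bigO (2 * k2).+1).
move=> /deriv_bigO_taylor[p [sp pO]].
have [C hC] : unif_bigO (1 + 2 * k2) (fun h _ =>
   \sum_l - b l * (dG h (c l) - (p h).[c l])).
  apply: unif_bigO_sum => l _; apply: (@unif_bigOM _ 0).
    exact: unif_bigO_cst.
  exact: unif_bigO_eval pO.
(* [D] bounds the Taylor remainder and [C] the integral of [p h]. *)
have [D hD] := pO; exists (D + C); near=> h => _ _.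
pose G t := H (\col_i (w h i).[t]).
have hu : LIM_solution P s ch bh c b S H y0 h (u h).
  by near: h; apply: filterS uP => ? [].
have dGh (t : R) : 0 <= t <= 1 -> is_derive t 1 G (dG h t).
  by rewrite /G; move: t; near: h; exact: hdG.
have wK (t : R) : 0 <= t <= 1 -> K (\col_i (w h i).[t]).
  by move: t; near: h; exact: lim_curve_compact.
(* [dG] comes from an existential; uniqueness of derivatives identifies it with the chain rule
   expression at the nodes. *)
have Q0 : \sum_l b l * dG h (c l) = 0.
  rewrite -[RHS](lim_energy Sskew c01 hu); apply: eq_bigr => l _.
  have d1 := dGh _ (c01 l).
  have d2 := is_derive_lim_curve (Hdiff (KU (wK _ (c01 l)))).
  by rewrite -(derive_val (is_derive := d1)) (derive_val (is_derive := d2)).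
(* Quadrature is exact on [p h] and gives 0 on [dG h], so the integral of [p h] is a combination of
   remainders, hence small. *)
have Ip : integral01 (p h) = \sum_l - b l * (dG h (c l) - (p h).[c l]).
  rewrite -(gauss_exact hP hGL2)//.
  under [RHS]eq_bigr do rewrite mulrBr mulNr mulNr opprK.
  by rewrite big_split/= sumrN Q0 oppr0 add0r.
pose F t := G t - (primitive (p h)).[t].
have dF (t : R) : 0 <= t <= 1 -> is_derive t 1 F (dG h t - (p h).[t]).
  move=> t01; apply: (@is_deriveB _ _ _ G (horner (primitive (p h)))).
    exact: dGh.
  by have := is_derive_poly (primitive (p h)) t; rewrite deriv_primitive.
have [||z z01] := @MVT_segment _ F (fun t => dG h t - (p h).[t]) 0 1 ler01.
- by move=> z /subset_itv_oo_cc; rewrite in_itv/= => /dF.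
- apply: derivable_within_continuous => z; rewrite in_itv/= => /dF ?.
  exact: ex_derive.
rewrite subr0 mulr1 /F primitive0 subr0 addrAC => /eqP; rewrite subr_eq => /eqP.
rewrite -/(integral01 _) Ip /G lim_curve0 -(lim_curveP hu) ?lexx ?ler01// mul1r.
move=> ->; rewrite addnC mulrDl (le_trans (ler_normD _ _))// lerD//.
  move: z01; rewrite in_itv/=; move: z; near: h; exact: hD.
have hCh : forall t : R, 0 <= t <= 1 ->
    `|\sum_l - b l * (dG h (c l) - (p h).[c l])| <= C * h ^+ (1 + 2 * k2).
  by near: h; exact: hC.
by apply: (hCh 0); rewrite lexx ler01.
Unshelve. all: by end_near. Qed.

End Bootstrap.

Theorem theorem3 (R : realType) (m s k1 k2 : nat)
    (hs : (1 <= s)%N) (hk1 : (s <= k1)%N) (hk2 : (s <= k2)%N)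
    (P : nat -> {poly R}) (hP : orthonormal_legendre P)
    (ch bh : 'I_k1 -> R) (hGL1 : gauss_legendre P ch bh)
    (c b : 'I_k2 -> R) (hGL2 : gauss_legendre P c b)
    (S : 'cV[R]_m -> 'M[R]_m) (H : 'cV[R]_m -> R)
    (y0 : 'cV[R]_m) (U : set 'cV[R]_m) (openU : open U) (Uy0 : U y0)
    (Sskew : forall y, S y = - (S y)^T)
    (Ssmooth : forall i j, smooth_on U (fun y => S y i j))
    (Hdiff : forall y, U y -> differentiable H y)
    (gradHsmooth : forall i, smooth_on U (fun y => grad H y i 0)) :
  ((exists nu : nat, poly_fun_le nu H /\ nu%:R <= (2 * k2)%:R / s%:R :> R) ->
   forall (h : R) (u : 'cV[{poly R}]_m),
     0 < h -> LIM_solution P s ch bh c b S H y0 h u ->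
     H (vhorner u h) - H y0 = 0)
  /\
  (~ (exists nu : nat, poly_fun_le nu H /\ nu%:R <= (2 * k2)%:R / s%:R :> R) ->
   forall (K : set 'cV[R]_m) (u : R -> 'cV[{poly R}]_m),
     compact K -> nbhs y0 K -> K `<=` U ->
     (\forall h \near 0^'+,
        LIM_solution P s ch bh c b S H y0 h (u h) /\
        forall t : R, 0 <= t <= h -> K (vhorner (u h) t)) ->
     (fun h : R => H (vhorner (u h) h) - H y0)
       =O_ (0^'+) (fun h : R => h ^+ (2 * k2 + 1))).
Proof.
split=> [[nu [Hnu]]|_ K u cK _ KU uP].
  (* As [s] is positive, the real inequality on [nu] becomes [nu * s <= 2 * k2] in the naturals. *)
  rewrite ler_pdivlMr ?ltr0n// -natrM ler_nat => nus h u _ hu.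
  by apply/eqP; rewrite subr_eq0; apply/eqP;
    exact: (lim_energy_poly Sskew hP hGL2 Hnu nus hu).
have [C hC] := lim_energy_bigO hk1 hk2 hP hGL1 hGL2 Ssmooth gradHsmooth cK KU uP
  Sskew Hdiff.
(* A positive constant is required here, whereas [C] may be 0. *)
apply/eqO_exP; exists (`|C| + 1); first by rewrite ltr_wpDl.
near=> h.
have /le_trans -> // : `|H (vhorner (u h) h) - H y0| <= C * h ^+ (2 * k2 + 1).
  have hCh : forall t : R, 0 <= t <= 1 ->
      `|H (vhorner (u h) h) - H y0| <= C * h ^+ (2 * k2 + 1).
    by near: h; exact: hC.
  by apply: (hCh 0); rewrite lexx ler01.
rewrite (le_trans (ler_norm _))// normrM ler_wpM2r// lerDl.
Unshelve. all: by end_near. Qed.
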